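(* Let $r\ge 2$ be an integer and let $H$ be a graph with chromatic number $\chi(H)=r+1$. For each $n$, let $ex_{\mu_r}(n,H)$ denote the maximum of the $r$-clique spectral radius $\mu_r(G)$ over all $H$-free simple graphs $G$ on $n$ vertices. Then, as $n\to\infty$, \[ ex_{\mu_{r}}(n,H)=\left(\frac{1}{r^{r-1}}+o(1)\right)n^{r-1}. \]
   Context: All graphs are simple and undirected. A $t$-clique of a graph $G$ is a set of $t$ vertices inducing a complete subgraph; $C_t(G)$ denotes the set of $t$-cliques of $G$. For a graph $G$ with vertex set $\{1,\dots,n\}$, the $t$-clique tensor $\mathcal{A}(G)=(a_{i_1\cdots i_t})$ is the order $t$, dimension $n$ tensor with $a_{i_1 i_2\cdots i_t}=\frac{1}{(t-1)!}$ if $\{i_1,\dots,i_t\}\in C_t(G)$ (in particular the $i_j$ are distinct) and $a_{i_1\cdots i_t}=0$ otherwise. For an order $m$ dimension $n$ tensor $\mathcal{A}$ and $x\in\mathbb{C}^n$, $\mathcal{A}x^{m-1}$ is the vector whose $i$-th component is $\sum_{i_2,\dots,i_m=1}^n a_{i i_2\cdots i_m}x_{i_2}\cdots x_{i_m}$; $\lambda\in\mathbb{C}$ is an eigenvalue of $\mathcal{A}$ if there is a nonzero $x\in\mathbb{C}^n$ with $\mathcal{A}x^{m-1}=\lambda x^{[m-1]}$, where $x^{[m-1]}=(x_1^{m-1},\dots,x_n^{m-1})^T$. The $t$-clique spectral radius $\mu_t(G)$ is the largest modulus of an eigenvalue of the $t$-clique tensor of $G$. A graph is $H$-free if it contains no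 subgraph isomorphic to $H$. *)

(* Defs.v *)
From HB Require Import structures.
From mathcomp Require Import all_boot all_order all_algebra.
From mathcomp Require Import complex.
From mathcomp Require Import boolp classical_sets reals.
Set Implicit Arguments. Unset Strict Implicit. Unset Printing Implicit Defensive.
Import Order.TTheory GRing.Theory Num.Theory.
Local Open Scope ring_scope.

Definition simple_graph (V : finType) (e : rel V) : Prop :=
  symmetric e /\ irreflexive e.

Definition colorable (V : finType) (e : rel V) (k : nat) : Prop :=
  exists f : V -> 'I_k, forall u v, e u v -> f u != f v.

Definition chromatic_number_is (V : finType) (e : rel V) (k : nat) : Prop :=
  colorable e k /\ forall j, colorable e j -> (k <= j)%N.

Definition contains_subgraph (VH VG : finType) (eH : rel VH) (eG : rel VG) : Prop :=
  exists f : VH -> VG, injective f /\ forall u v, eH u v -> eG (f u) (f v).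

Definition H_free (VH VG : finType) (eH : rel VH) (eG : rel VG) : Prop :=
  ~ contains_subgraph eH eG.

Definition full_index (n t : nat) (i : 'I_n) (s : {ffun 'I_t.-1 -> 'I_n})
  (j : 'I_t.-1.+1) : 'I_n :=
  match unlift ord0 j with None => i | Some k => s k end.

Definition is_t_clique (n t : nat) (e : rel 'I_n) (S : {set 'I_n}) : bool :=
  (#|S| == t) && [forall u in S, forall v in S, (u != v) ==> e u v].

Section CliqueTensor.
Variable R : realType.
Local Notation C := (R[i]).

Definition clique_tensor (n t : nat) (e : rel 'I_n) (i : 'I_n)
  (s : {ffun 'I_t.-1 -> 'I_n}) : C :=
  if is_t_clique t e [set full_index i s j | j in 'I_t.-1.+1]
  then ((t.-1)`!%:R)^-1 else 0.
Arguments clique_tensor {n} t e i s.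

Definition tensor_apply (n t : nat) (e : rel 'I_n) (x : 'I_n -> C) (i : 'I_n) : C :=
  \sum_(s : {ffun 'I_t.-1 -> 'I_n}) clique_tensor t e i s * \prod_(k < t.-1) x (s k).
Arguments tensor_apply {n} t e x i.

Definition tensor_eigenvalue (n t : nat) (e : rel 'I_n) (lam : C) : Prop :=
  exists x : 'I_n -> C, (exists i, x i != 0) /\
    forall i, tensor_apply t e x i = lam * x i ^+ t.-1.
Arguments tensor_eigenvalue {n} t e lam.

Definition clique_spectral_radius (n t : nat) (e : rel 'I_n) : R :=
  sup ([set ComplexField.Normc.normc lam | lam in tensor_eigenvalue t e])%classic.
Arguments clique_spectral_radius {n} t e.

Definition ex_mu (r n : nat) (VH : finType) (eH : rel VH) : R :=
  sup ([set x : R | exists e : rel 'I_n,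
          [/\ simple_graph e, H_free eH e & x = clique_spectral_radius r e]])%classic.
End CliqueTensor.
Arguments clique_tensor {R n} t e i s.
Arguments tensor_apply {R n} t e x i.
Arguments tensor_eigenvalue {R n} t e lam.
Arguments clique_spectral_radius {R n} t e.
Arguments ex_mu {R} r n {VH} eH.

(* Main.v *)
Require Import Defs.
From HB Require Import structures.
From mathcomp Require Import all_boot all_order all_algebra.
From mathcomp Require Import complex boolp classical_sets reals.
From mathcomp Require Import lra ring zify.
Import Order.TTheory GRing.Theory Num.Theory.
Set Implicit Arguments.
Unset Strict Implicit.
Unset Printing Implicit Defensive.
Local Open Scope ring_scope.

(** Let lam be an eigenvalue with eigenvector x, and let p be the probability
    |x_i| / sum |x_j| on the vertices. The eigenvalue equations and Jensen's
    inequality give |lam| (r-1)! <= n^(r-1) t_r, where t_k is the probability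
    that k independent p-distributed vertices form an (ordered) clique; they
    also give p_i <= r/n as soon as |lam| >= (n/r)^(r-1). If |lam| exceeds
    (r^(1-r) + eps) n^(r-1), then t_r exceeds its Turan value r!/r^r by eps, and
    the Moon-Moser inequality bounds t_(r+1) away from 0. Repeated use of
    Jensen's inequality bounds away from 0 the probability of a complete
    (r+1)-partite blow-up with |V(H)| sampled vertices per part. Since
    p = O(1/n), for large n such a blow-up occurs with no repeated vertex, and
    it contains H. Working with the distribution p avoids the removal lemma.
    Conversely, the indicator of the non-isolated vertices is an eigenvector of
    the balanced complete r-partite graph on r floor(n/r) vertices, with
    eigenvalue floor(n/r)^(r-1). *)

(** * Expectations, independent sampling and blow-ups *)

Section Expectation.
Variable R : realFieldType.

(** [P] carries the mass: pointwise comparisons are required only on it. For iterated expectations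
    it records the length of the sampled sequence. *)
Record expectation (T : Type) (P : pred T) (A : (T -> R) -> R) : Prop :=
  Expectation {
    expectD : forall f g, A (fun x => f x + g x) = A f + A g;
    expectZ : forall c f, A (fun x => c * f x) = c * A f;
    expect_le : forall f g, (forall x, P x -> f x <= g x) -> A f <= A g;
    expect1 : A (fun=> 1) = 1 }.

Section Theory.
Variables (T : Type) (P : pred T) (A : (T -> R) -> R).
Hypothesis eA : expectation P A.

Lemma eq_expect f g : (forall x, P x -> f x = g x) -> A f = A g.
Proof.
by move=> fg; apply/eqP; rewrite eq_le !(expect_le eA) // => x /fg ->.
Qed.

Lemma expect_cst c : A (fun=> c) = c.
Proof.
by rewrite -[RHS]mulr1 -(expect1 eA) -(expectZ eA); apply: eq_expect => x; rewrite mulr1.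
Qed.

Lemma expect_ge0 f : (forall x, P x -> 0 <= f x) -> 0 <= A f.
Proof. by move=> f0; rewrite -[leLHS]expect_cst; apply: (expect_le eA). Qed.

Lemma expect_sum (I : finType) (f : I -> T -> R) :
  A (fun x => \sum_i f i x) = \sum_i A (f i).
Proof.
elim: (index_enum I) => [|i s IHs].
  by rewrite big_nil -[RHS](expect_cst 0); apply: eq_expect => x _; rewrite big_nil.
rewrite big_cons -IHs -(expectD eA).
by apply: eq_expect => x _; rewrite big_cons.
Qed.

Lemma expect_gt0 f : 0 < A f -> exists2 x, P x & 0 < f x.
Proof.
move=> Af; apply: contrapT => nf; move: Af; apply/negP; rewrite -leNgt.
rewrite -[leRHS]expect_cst; apply: (expect_le eA) => x Px; rewrite leNgt.
by apply/negP => fx; apply: nf; exists x.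
Qed.

End Theory.

(** Convexity of the power function: its graph lies above the tangent at [a]. Multiplying the
    inductive bound by [x] leaves a surplus of [m.+1%:R * a ^+ m * (x - a) ^+ 2]. *)
Lemma exprn_tangent (a x : R) m : 0 <= a -> 0 <= x ->
  a ^+ m.+1 + m.+1%:R * a ^+ m * (x - a) <= x ^+ m.+1.
Proof.
move=> a0 x0; elim: m => [|m IHm]; first by rewrite !expr1 expr0 mulr1 mul1r addrC subrK.
have := ler_wpM2l x0 IHm; rewrite -exprS; apply: le_trans.
rewrite -subr_ge0 [leRHS](_ : _ = m.+1%:R * a ^+ m * (x - a) ^+ 2).
  by rewrite mulr_ge0 ?sqr_ge0 ?mulr_ge0 ?exprn_ge0.
rewrite -[m.+2%:R]natr1 !exprS.
by move: (a ^+ m) (m.+1%:R) => b c; ring.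
Qed.

(** Averaging the tangent inequality at the mean [A f] makes the linear term vanish. *)
Lemma jensen (T : Type) (P : pred T) (A : (T -> R) -> R) f m :
  expectation P A -> (forall x, P x -> 0 <= f x) ->
  A f ^+ m <= A (fun x => f x ^+ m).
Proof.
move=> eA f0; case: m => [|m]; first by rewrite expr0 (expect1 eA).
set a := A f; have a0 : 0 <= a by apply: expect_ge0 eA _ f0.
have := expect_le eA (fun x Px => exprn_tangent m a0 (f0 x Px)).
apply: le_trans.
rewrite (expectD eA) (expectZ eA) (expectD eA) !(expect_cst eA) -/a.
by rewrite subrr mulr0 addr0.
Qed.

(** For an expectation [A], this averages [F] over [k] independent draws, listed in order. *)
Fixpoint iterE (T : Type) (A : (T -> R) -> R) (k : nat) (F : seq T -> R) : R :=
  if k is k'.+1 then A (fun v => iterE A k' (fun s => F (v :: s))) else F [::].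

Definition avg (V : finType) (p : V -> R) (f : V -> R) := \sum_v p v * f v.

Lemma iterE_expectation (T : Type) (P : pred T) (A : (T -> R) -> R) k :
  expectation P A ->
  expectation (fun s => (size s == k) && all P s) (iterE A k).
Proof.
move=> eA; elim: k => [|k IHk]; split => //=.
- by move=> f g; apply.
- move=> f g; rewrite -(expectD eA); apply: (eq_expect eA) => x _.
  exact: (expectD IHk).
- move=> c f; rewrite -(expectZ eA); apply: (eq_expect eA) => x _.
  exact: (expectZ IHk).
- move=> f g fg; apply: (expect_le eA) => x Px; apply: (expect_le IHk) => s.
  by case/andP=> sk Ps; apply: fg; rewrite /= eqSS sk Px.
- rewrite -[RHS](expect1 eA); apply: (eq_expect eA) => x _; exact: (expect1 IHk).
Qed.

Lemma avg_expectation (V : finType) (p : V -> R) :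
  (forall v, 0 <= p v) -> \sum_v p v = 1 -> expectation predT (avg p).
Proof.
move=> p0 p1; rewrite /avg; split.
- by move=> f g; rewrite -big_split; apply: eq_bigr => v _; rewrite mulrDr.
- by move=> c f; rewrite mulr_sumr; apply: eq_bigr => v _; rewrite mulrCA.
- by move=> f g fg; apply: ler_sum => v _; rewrite ler_wpM2l ?fg.
- by rewrite -[RHS]p1; apply: eq_bigr => v _; rewrite mulr1.
Qed.

(** A form of Fubini's theorem: a finite weighted sum commutes with any linear functional, so [B]
    can stay abstract. *)
Lemma avg_exchange (V : finType) (p : V -> R) (T : Type) (P : pred T)
    (B : (T -> R) -> R) (F : V -> T -> R) :
  expectation P B -> avg p (fun v => B (F v)) = B (fun x => avg p (F^~ x)).
Proof.
move=> eB; rewrite /avg (expect_sum eB).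
by apply: eq_bigr => v _; rewrite (expectZ eB).
Qed.

Lemma iterE_avg_exchange (V : finType) (p : V -> R) (T : Type) (P : pred T)
    (B : (T -> R) -> R) h (F : seq V -> T -> R) :
  expectation P B ->
  iterE (avg p) h (fun b => B (F b)) = B (fun x => iterE (avg p) h (F^~ x)).
Proof.
move=> eB; elim: h F => [|h IHh] F //=; rewrite -(avg_exchange _ _ eB).
by apply: eq_bigr => v _; rewrite IHh.
Qed.

Lemma iterE_prod (T : Type) (P : pred T) (A : (T -> R) -> R) h (f : T -> R) :
  expectation P A -> iterE A h (fun b => \prod_(v <- b) f v) = A f ^+ h.
Proof.
move=> eA; elim: h => [|h IHh] /=; first by rewrite big_nil expr0.
rewrite exprSr -(expectZ eA); apply: (eq_expect eA) => v _.
rewrite -IHh mulrC -(expectZ (iterE_expectation h eA)).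
by apply: (eq_expect (iterE_expectation h eA)) => b _; rewrite big_cons.
Qed.

Lemma jensen_iterE (T : Type) (P : pred T) (A : (T -> R) -> R) k F m :
  expectation P A -> (forall s, 0 <= F s) ->
  iterE A k F ^+ m <= iterE A k (fun s => F s ^+ m).
Proof. by move=> eA F0; apply: (jensen _ (iterE_expectation k eA)) => s _. Qed.

(* [transprod F [:: b1; ...; bk]] is the product of [F [:: v1; ...; vk]]
   over all choices of [vi] in [bi]. *)
Fixpoint transprod (T : Type) (F : seq T -> R) (bs : seq (seq T)) : R :=
  if bs is b :: bs' then \prod_(v <- b) transprod (fun s => F (v :: s)) bs'
  else F [::].

Lemma transprod_prod (T U : Type) (F : U -> seq T -> R) (b : seq U) bs :
  transprod (fun s => \prod_(u <- b) F u s) bs =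
  \prod_(u <- b) transprod (F u) bs.
Proof.
elim: bs F => [|c bs IHbs] F //=; rewrite exchange_big /=.
by apply: eq_bigr => v _; rewrite IHbs.
Qed.

Lemma transprod_ge0 (T : Type) (F : seq T -> R) bs :
  (forall s, 0 <= F s) -> 0 <= transprod F bs.
Proof.
elim: bs F => [|b bs IHbs] F F0 //=.
by apply: prodr_ge0 => v _; apply: IHbs.
Qed.

Lemma transprod_le1 (T : Type) (F : seq T -> R) bs :
  (forall s, 0 <= F s <= 1) -> transprod F bs <= 1.
Proof.
elim: bs F => [|b bs IHbs] F F01 /=; first by case/andP: (F01 [::]).
apply: prodr_ile1 => v _; rewrite transprod_ge0 ?IHbs // => s.
by case/andP: (F01 (v :: s)).
Qed.

Lemma transprod_neq0 (T : eqType) (F : seq T -> R) bs s :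
  transprod F bs != 0 -> size s = size bs ->
  (forall i, (i < size bs)%N -> forall x0, nth x0 s i \in nth [::] bs i) ->
  F s != 0.
Proof.
elim: bs F s => [|b bs IHbs] F [|v s] //= T0 [ss] sb.
apply: (IHbs (fun s => F (v :: s))) => // [|i ilt x0]; last exact: (sb i.+1).
have /= vb := sb 0 isT v.
by apply: contraNneq T0 => Tv; rewrite (big_rem v) //= Tv mul0r.
Qed.

(* Each of the [k] coordinates is replaced by [h] independent copies in turn;
   Jensen's inequality shows that one replacement raises the expectation at
   worst to the power [h]. *)
Lemma blowup_expectation (V : finType) (p : V -> R) h k (F : seq V -> R) :
  expectation predT (avg p) -> (forall s, 0 <= F s) ->
  iterE (avg p) k F ^+ (h ^ k)%N <=
  iterE (iterE (avg p) h) k (transprod F).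
Proof.
move=> ep; elim: k F => [|k IHk] F F0 /=; first by rewrite expr1.
have eh := iterE_expectation h ep; have ek := iterE_expectation k ep.
set G := fun b s => \prod_(v <- b) F (v :: s).
have G0 b s : 0 <= G b s by apply: prodr_ge0 => v _.
(* For a fixed tail [s] the [h] copies of the first coordinate are independent, so averaging over
   [b] gives an [h]-th power. Jensen over [b] and then over [s] yields this intermediate bound. *)
apply: (@le_trans _ _ (iterE (avg p) h (fun b => iterE (avg p) k (G b) ^+ (h ^ k)))).
  apply: le_trans (jensen _ eh _); last by move=> b _; apply: (expect_ge0 ek) => s _.
  rewrite (iterE_avg_exchange p h G ek) expnS exprM.
  rewrite lerXn2r ?nnegrE ?exprn_ge0 //; do ?by apply: (expect_ge0 ek).
  - by apply: (expect_ge0 ep) => v _; apply: (expect_ge0 ek) => s _.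
  - by apply: (expect_ge0 ek) => s _; apply: (expect_ge0 eh) => b _.
  rewrite (avg_exchange p (fun v s => F (v :: s)) ek).
  apply: le_trans (jensen_iterE _ _ ep _) _.
    by move=> s; apply: (expect_ge0 ep) => v _.
  apply: (expect_le ek) => s _.
  by rewrite /G (iterE_prod h (fun v => F (v :: s)) ep).
apply: (expect_le eh) => b _; apply: le_trans (IHk _ (G0 b)) _.
apply: (expect_le (iterE_expectation k eh)) => bs _.
by rewrite transprod_prod.
Qed.

Lemma iterE_repeat (V : finType) (p : V -> R) (d : R) h :
  expectation predT (avg p) -> (forall v, 0 <= p v <= d) ->
  iterE (avg p) h (fun s => (~~ uniq s)%:R) <= (h ^ 2)%:R * d.
Proof.
move=> ep pd; have p0 v : 0 <= p v by case/andP: (pd v).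
have pled v : p v <= d by case/andP: (pd v).
have d0 : 0 <= d.
  have [|v _ _] := expect_gt0 ep (f := fun=> 1); first by rewrite (expect1 ep) ltr01.
  exact: le_trans (p0 v) (pled v).
elim: h => [|h IHh] /=; first by rewrite mul0r.
have eh := iterE_expectation h ep.
(* Union bound: either the first draw reappears later, or the later draws already repeat. The two
   costs add up because [h + h ^ 2 <= h.+1 ^ 2]. *)
apply: (@le_trans _ _ (iterE (avg p) h (fun s => avg p (fun v => (v \in s)%:R))
     + iterE (avg p) h (fun s => (~~ uniq s)%:R))).
  rewrite -[X in _ <= _ + X](expect_cst ep) -(avg_exchange p (fun v s => (v \in s)%:R) eh).
  rewrite -(expectD ep); apply: (expect_le ep) => v _.
  rewrite -(expectD eh); apply: (expect_le eh) => s _.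
  by case: (v \in s); case: (uniq s); rewrite /= ?addr0 ?add0r ?lerDl ?ler01.
apply: (@le_trans _ _ (h%:R * d + (h ^ 2)%:R * d)).
  apply: lerD IHh; rewrite -[leRHS](expect_cst eh).
  apply: (expect_le eh) => s /andP[/eqP <- _].
  rewrite /avg (eq_bigr (fun v => if v \in s then p v else 0)); last first.
    by move=> v _; case: ifP; rewrite ?mulr1 ?mulr0.
  rewrite -big_mkcond /=.
  apply: (@le_trans _ _ (\sum_(v in s) d)); first exact: ler_sum.
  by rewrite sumr_const -[d *+ _]mulr_natl ler_wpM2r // ler_nat card_size.
rewrite -mulrDl ler_wpM2r // -natrD ler_nat; nia.
Qed.

End Expectation.

(** * The Moon-Moser inequality for weighted clique densities *)

Section CliqueDensity.
Variable R : realFieldType.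

Lemma iterE_sum (T : Type) (P : pred T) (A : (T -> R) -> R) k (g : T -> R) :
  expectation P A -> iterE A k (fun b => \sum_(v <- b) g v) = k%:R * A g.
Proof.
move=> eA; elim: k => [|k IHk] /=; first by rewrite big_nil mul0r.
have ek := iterE_expectation k eA.
rewrite -[RHS](_ : A (fun v => g v + k%:R * A g) = _); last first.
  by rewrite (expectD eA) (expect_cst eA) -[k.+1]addn1 natrD; ring.
apply: (eq_expect eA) => v _; rewrite -IHk -[X in X + _](expect_cst ek) -(expectD ek).
by apply: (eq_expect ek) => s _; rewrite big_cons.
Qed.

(** Weighted Cauchy-Schwarz: the expectation of [c x * (a * f x - b) ^+ 2] is nonnegative and equals
    [a * (a * m - b ^+ 2)], where [a] is positive. *)
Lemma expect_cauchy (T : Type) (P : pred T) (A : (T -> R) -> R) (c f : T -> R) :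
  expectation P A -> (forall x, 0 <= c x) -> 0 < A c ->
  A (fun x => c x * f x) ^+ 2 <= A c * A (fun x => c x * f x ^+ 2).
Proof.
move=> eA c0 Ac; set a := A c; set b := A (fun x => c x * f x).
set m := A (fun x => c x * f x ^+ 2).
have : 0 <= A (fun x => c x * (a * f x - b) ^+ 2).
  by apply: (expect_ge0 eA) => x _; rewrite mulr_ge0 ?sqr_ge0.
have -> (u v : R) : A (fun x => c x * (u * f x - v) ^+ 2) =
    u ^+ 2 * m + ((- (2 * u * v)) * b + v ^+ 2 * a).
  rewrite /a /b /m -!(expectZ eA) -!(expectD eA).
  by apply: (eq_expect eA) => x _; ring.
rewrite (_ : _ + _ = a * (a * m - b ^+ 2)); last by ring.
by rewrite pmulr_rge0 // subr_ge0.
Qed.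

(** Device for double counting: each entry is singled out in turn, the others keeping their
    order. *)
Fixpoint sum_splits (T : Type) (Q : T -> seq T -> R) (K : seq T) : R :=
  if K is v :: L then Q v L + sum_splits (fun u L' => Q u (v :: L')) L else 0.

(** The draws are exchangeable, so all [k.+1] positions contribute equally. *)
Lemma iterE_sum_splits (V : finType) (p : V -> R) k (Q : V -> seq V -> R) :
  expectation predT (avg p) ->
  iterE (avg p) k.+1 (sum_splits Q) =
  k.+1%:R * avg p (fun v => iterE (avg p) k (Q v)).
Proof.
move=> ep; elim: k Q => [|k IHk] Q.
  by rewrite /= mul1r; apply: (eq_expect ep) => v _; rewrite addr0.
have ek := iterE_expectation k.+1 ep.
rewrite -[k.+2]addn1 natrD mulrDl mul1r addrC.
have -> : iterE (avg p) (k.+1 + 1) (sum_splits Q) =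
    avg p (fun v => iterE (avg p) k.+1 (Q v) +
      iterE (avg p) k.+1 (sum_splits (fun u L => Q u (v :: L)))).
  by rewrite addn1; apply: (eq_expect ep) => v _; rewrite -(expectD ek).
rewrite (expectD ep); congr (_ + _).
rewrite (eq_expect ep (fun v _ => IHk (fun u L => Q u (v :: L)))) (expectZ ep).
by rewrite (avg_exchange p _ ep).
Qed.

Lemma eq_sum_splits (T : Type) (Q Q' : T -> seq T -> R) K :
  (forall v L, Q v L = Q' v L) -> sum_splits Q K = sum_splits Q' K.
Proof.
by elim: K Q Q' => //= v K IHK Q Q' QQ'; rewrite QQ' (IHK _ (fun u L => Q' u (v :: L))).
Qed.

(** Every split of [K] is a rearrangement of [K], so a symmetric factor is constant over the
    splits. *)
Lemma sum_splits_perm (T : eqType) (c : seq T -> R) (Q : T -> seq T -> R) K :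
  (forall s s', perm_eq s s' -> c s = c s') ->
  sum_splits (fun u L => c (u :: L) * Q u L) K = c K * sum_splits Q K.
Proof.
elim: K c Q => [|v K IHK] c Q cP /=; first by rewrite mulr0.
rewrite mulrDr -(IHK (fun s => c (v :: s))); last first.
  by move=> s s' ss'; apply: cP; rewrite perm_cons.
congr (_ + _); apply: eq_sum_splits => u L; congr (_ * _); apply: cP.
by rewrite -(cat1s u) -(cat1s v) perm_catCA.
Qed.

Lemma perm_pairwise (T : eqType) (e : rel T) s s' :
  symmetric e -> perm_eq s s' -> pairwise e s = pairwise e s'.
Proof.
move=> se; elim: s s' => [|x s IHs] s' ss'; first by move/perm_size: ss'; case: s'.
have xs' : x \in s' by rewrite -(perm_mem ss') mem_head.
case/splitPr: xs' ss' => s1 s2 ss'.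
have {}ss' : perm_eq s (s1 ++ s2).
  by rewrite -(perm_cons x) (permPl ss') perm_sym -cat1s perm_catCA.
rewrite /= (IHs _ ss') (perm_all _ ss') !pairwise_cat all_cat allrel_consr /=.
rewrite (eq_all (fun y => se x y)).
rewrite [all (e x) s2](eq_all (a2 := e^~ x)); last by move=> y; rewrite se.
by do !case: (all _ _) => //=; rewrite ?andbF.
Qed.

(** If some entry fails [a], only the deletion of a sole failing entry can contribute; otherwise all
    [size K] deletions do. *)
Lemma sum_splits_all_but_one (T : eqType) (a : pred T) (K : seq T) :
  (0 < size K)%N ->
  sum_splits (fun _ L => (all a L)%:R) K <= 1 + (size K).-1%:R * (all a K)%:R.
Proof.
have main b K' : sum_splits (fun _ L => (b && all a L)%:R) K' =
   b%:R * sum_splits (fun _ L => (all a L)%:R) K'.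
  rewrite -(sum_splits_perm (c := fun=> b%:R)) //.
  by apply: eq_sum_splits => v L; rewrite -mulnb natrM.
suff H K' : sum_splits (fun _ L => (all a L)%:R) K' <= 
    if all a K' then (size K')%:R else 1.
  move=> K0; apply: le_trans (H K) _; case: (all a K); last by rewrite mulr0 addr0.
  by rewrite mulr1 nat1r prednK.
elim: K' => [|v K' IHK] //=.
have -> := main (a v) K'.
case: (a v) => /=; last by rewrite mul0r addr0; case: (all _ _); rewrite ?ler01.
rewrite mul1r; case: (all a K') IHK => /=; last by rewrite add0r.
by move=> IHK; rewrite -[leRHS]nat1r lerD2l.
Qed.

Definition clique_density (V : finType) (p : V -> R) (e : rel V) k : R :=
  iterE (avg p) k (fun s => (pairwise e s)%:R).

(** Cauchy-Schwarz bounds the square of the mean common degree of a [k]-clique by its second moment.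
    That moment counts two vertices [u], [w] joined to one clique [L], and is bounded by double
    counting. *)
Lemma moon_moser (V : finType) (p : V -> R) (e : rel V) k :
  expectation predT (avg p) -> symmetric e -> 0 < clique_density p e k ->
  k.+1%:R * clique_density p e k.+1 ^+ 2 <= clique_density p e k *
    (clique_density p e k.+1 + k%:R * clique_density p e k.+2).
Proof.
move=> ep se tk0; set t := clique_density p e in tk0 *.
have ek j := iterE_expectation j ep.
(* The mass of the common neighbourhood of [L]. *)
pose deg L := avg p (fun w => (all (e w) L)%:R).
have tS j : t j.+1 = iterE (avg p) j (fun L => (pairwise e L)%:R * deg L).
  rewrite /deg -(eq_expect (ek j) (fun L _ => expectZ ep _ _)).
  rewrite -(avg_exchange p (fun w L => (pairwise e L)%:R * (all (e w) L)%:R) (ek j)).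
  apply: (eq_expect ep) => w _; apply: (eq_expect (ek j)) => L _ /=.
  by rewrite andbC -natrM mulnb.
have cs : t k.+1 ^+ 2 <=
    t k * iterE (avg p) k (fun L => (pairwise e L)%:R * deg L ^+ 2).
  by rewrite tS; apply: (expect_cauchy _ (ek k)).
suff H : k.+1%:R * iterE (avg p) k (fun L => (pairwise e L)%:R * deg L ^+ 2)
   <= t k.+1 + k%:R * t k.+2.
  apply: le_trans (ler_wpM2l (ler0n _ _) cs) _.
  by rewrite mulrCA ler_wpM2l // ltW.
(* For a [k.+1]-clique, this counts the subsequences of length [k] wholly joined to [w]: at most
   one, unless [w] extends the whole clique. *)
pose S w := iterE (avg p) k.+1
  (sum_splits (fun u L => (pairwise e (u :: L))%:R * (all (e w) L)%:R)).
have Sle w : S w <= t k.+1 +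
    k%:R * iterE (avg p) k.+1 (fun K => (pairwise e (w :: K))%:R).
  rewrite /S -(expectZ (ek k.+1)) -(expectD (ek k.+1)).
  apply: (expect_le (ek k.+1)) => K /andP[/eqP sK _].
  rewrite (sum_splits_perm (c := fun s => (pairwise e s)%:R)); last first.
    by move=> s s' ss'; rewrite (perm_pairwise se ss').
  have := @sum_splits_all_but_one _ (e w) K; rewrite sK => /(_ isT) /= H.
  apply: le_trans (ler_wpM2l _ H) _; rewrite ?ler0n // mulrDr mulr1 mulrCA.
  by rewrite [all _ _ && _]andbC -mulnb natrM.
have := expect_le ep (fun w _ => Sle w).
rewrite (expectD ep) (expect_cst ep) (expectZ ep); apply: le_trans.
rewrite (eq_expect ep (fun w _ => iterE_sum_splits k _ ep)) (expectZ ep).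
rewrite ler_wpM2l //.
have -> : iterE (avg p) k (fun L => (pairwise e L)%:R * deg L ^+ 2) =
  iterE (avg p) k (fun L => avg p (fun w => avg p (fun u =>
     (pairwise e (u :: L))%:R * (all (e w) L)%:R))).
  apply: (eq_expect (ek k)) => L _.
  rewrite (eq_expect ep (g := fun w => (pairwise e L)%:R * deg L * (all (e w) L)%:R)).
    by rewrite (expectZ ep) -/(deg L); ring.
  move=> w _; rewrite -mulrA [deg L * _]mulrC mulrA -(expectZ ep).
  by apply: (eq_expect ep) => u _; rewrite /= -mulnb natrM; ring.
rewrite -(avg_exchange p _ (ek k)); apply: (expect_le ep) => w _.
by rewrite -(avg_exchange p _ (ek k)).
Qed.

End CliqueDensity.

(** * From a surplus of r-cliques to many (r+1)-cliques *)

Section Supersaturation.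
Variable R : realFieldType.

(** Expanding the product gives [2 ^ size s - 1] terms besides the main one; each contains a factor
    [c] and is at most [c]. *)
Lemma prod_addr_le (I : Type) (s : seq I) (a : I -> R) (c : R) :
  (forall i, 0 <= a i <= 1) -> 0 <= c <= 1 ->
  \prod_(i <- s) (a i + c) <= \prod_(i <- s) a i + c * ((2 ^ size s)%:R - 1).
Proof.
move=> a01 /andP[c0 c1]; elim: s => [|i s IHs]; first by rewrite !big_nil subrr mulr0 addr0.
rewrite !big_cons expnS natrM; have /andP[ai0 ai1] := a01 i.
have P1 : \prod_(j <- s) a j <= 1 by apply: prodr_ile1 => j _.
have B1 : 1 <= (2 ^ size s)%:R :> R by rewrite ler1n expn_gt0.
apply: le_trans (ler_wpM2l (addr_ge0 ai0 c0) IHs) _.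
move: (\prod_(j <- s) a j) (_ ^ _)%:R P1 B1 => P B P1 B1.
have h1 : c * P <= c by rewrite ler_piMr.
have h2 : a i * (c * (B - 1)) <= c * (B - 1).
  by rewrite ler_piMl // mulr_ge0 // subr_ge0.
have h3 : c * (c * (B - 1)) <= c * (B - 1).
  by rewrite ler_piMl // mulr_ge0 // subr_ge0.
lra.
Qed.

(** Downward induction from [k = r], where the claim is the assumed bound on [t r.+1]; the
    Moon-Moser hypothesis passes from [l.+1] to [l]. *)
Lemma ratio_chain (t : nat -> R) r (c : R) :
  (forall k, (k <= r)%N -> 0 < t k) ->
  (forall k, (k < r)%N ->
    k.+1%:R * t k.+1 ^+ 2 <= t k * (t k.+1 + k%:R * t k.+2)) ->
  0 <= c -> t r.+1 <= c * t r ->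
  forall k, (k <= r)%N -> r%:R * t k.+1 <= (r%:R - k%:R * (1 - c)) * t k.
Proof.
move=> t0 mm c0 tr k kr; rewrite -(subKn kr).
elim: (r - k)%N (leq_subr k r) => [|j IHj] jr.
  rewrite subn0 mulrBr mulr1 opprB addrC subrK -mulrA ler_wpM2l //.
have {IHj} := IHj (ltnW jr); set l := (r - j.+1)%N.
have -> : (r - j)%N = l.+1 by rewrite /l; lia.
have lr : (l < r)%N by rewrite /l; lia.
move=> H; have {mm} := mm l lr; have tl := t0 l (ltnW lr); have tl1 := t0 l.+1 lr.
move=> mm; rewrite -(ler_pM2l (_ : 0 < l.+1%:R * t l.+1)); last by rewrite mulr_gt0 ?ltr0n.
have h1 := ler_wpM2l (ler0n R r) mm.
have h2 := ler_wpM2l (ler0n R l) (ler_wpM2l (ltW tl) H).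
rewrite -[l.+1%:R]nat1r in h1 h2 *.
lra.
Qed.

(** Multiplying the ratio bounds gives factors at most [(r - i) / r + c]. Their main product is
    r!/r^r, and [prod_addr_le] controls the error. *)
Lemma ratio_chain_prod (t : nat -> R) r (c : R) : (0 < r)%N -> 
  t 0 = 1 -> (forall k, (k <= r)%N -> 0 < t k) -> 0 <= c <= 1 ->
  (forall k, (k <= r)%N -> r%:R * t k.+1 <= (r%:R - k%:R * (1 - c)) * t k) ->
  t r <= r`!%:R / r%:R ^+ r + c * (2 ^ r)%:R.
Proof.
move=> r0 t0 tp c01 H; have r0' : 0 < r%:R :> R by rewrite ltr0n.
have /andP[c0 c1] := c01.
pose a (i : nat) : R := (r - i)%:R / r%:R.
have a01 i : 0 <= a i <= 1.
  by rewrite divr_ge0 ?ler0n //= ler_pdivrMr // mul1r ler_nat leq_subr.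
have tle k : (k <= r)%N -> t k <= \prod_(i <- iota 0 k) (a i + c).
  elim: k => [|k IHk] kr; first by rewrite big_nil t0.
  rewrite -addn1 iotaD big_cat /= big_seq1 add0n addn1 mulrC.
  have ak0 : 0 <= a k + c by case/andP: (a01 k) => ? _; rewrite addr_ge0.
  apply: le_trans (ler_wpM2l ak0 (IHk (ltnW kr))).
  rewrite -(ler_pM2l r0'); apply: le_trans (H k (ltnW kr)) _.
  rewrite mulrA ler_wpM2r //; first by rewrite ltW // tp // ltnW.
  rewrite [leRHS]mulrDr /a [_ * (_ / _)]mulrC divfK ?gt_eqF // natrB ?(ltnW kr) //.
  have : k%:R * c <= r%:R * c by rewrite ler_wpM2r // ler_nat ltnW.
  lra.
apply: le_trans (tle r (leqnn r)) _; apply: le_trans (prod_addr_le _ a01 c01) _.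
rewrite size_iota; apply: (@le_trans _ _ (\prod_(i <- iota 0 r) a i + c * (2 ^ r)%:R)).
  by rewrite lerD2l ler_wpM2l // gerBl.
rewrite lerD2r -{1}(subn0 r) -/(index_iota 0 r) prodf_div.
rewrite -natr_prod big_mkord -ffact_prod ffactnn.
by rewrite big_const_seq count_predT size_iota subn0 iter_mulr mulr1.
Qed.

Section Density.
Variables (V : finType) (p : V -> R) (e : rel V).
Hypotheses (ep : expectation predT (avg p)) (se : symmetric e).
Local Notation t := (clique_density p e).

Lemma clique_density_ge0 k : 0 <= t k.
Proof. by apply: (expect_ge0 (iterE_expectation k ep)) => s _. Qed.

Lemma clique_density_le1 k : t k <= 1.
Proof.
have ek := iterE_expectation k ep.
rewrite -(expect1 ek); by apply: (expect_le ek) => s _; rewrite lern1 leq_b1.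
Qed.

Lemma clique_densityS_le k : t k.+1 <= t k.
Proof.
have ek := iterE_expectation k ep.
rewrite -[t k](expect_cst ep); apply: (expect_le ep) => v _.
apply: (expect_le ek) => s _ /=; rewrite ler_nat; by case: (all _ _).
Qed.

(* Moon-Moser says that (1 - t_(k+1) / t_k) / k is nonincreasing in k, so a tiny
   value of t_(r+1) forces t_r down to its value r!/r^r on the Turan graph. *)
Lemma clique_supersaturation r (c : R) : (0 < r)%N -> 0 < c <= 1 ->
  r`!%:R / r%:R ^+ r + c * (2 ^ r)%:R < t r -> c * t r < t r.+1.
Proof.
move=> r0 /andP[c0 c1] tr; rewrite ltNge; apply/negP => trS.
have : 0 < t r.
  apply: le_lt_trans tr.
  by rewrite addr_ge0 ?divr_ge0 ?mulr_ge0 ?exprn_ge0 ?ler0n ?(ltW c0).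
move=> tr0.
have tmono k j : (t (k + j) <= t k).
  elim: j => [|j IHj]; first by rewrite addn0.
  by rewrite addnS (le_trans (clique_densityS_le _)).
have tp k : (k <= r)%N -> 0 < t k.
  by move=> kr; apply: lt_le_trans tr0 _; rewrite -(subnKC kr).
move: tr; apply/negP; rewrite -leNgt.
apply: ratio_chain_prod => //; first by rewrite ltW.
apply: ratio_chain (ltW c0) trS => // k kr.
by apply: moon_moser => //; apply: tp; apply: ltnW.
Qed.

End Density.

(** * Finding the forbidden graph in a blow-up of a clique *)

Section Embedding.
Variables (V : finType) (e : rel V).
Hypotheses (se : symmetric e) (ie : irreflexive e).
Variables (VH : finType) (eH : rel VH).

(** A vertex [u] goes to the block of its colour, at its own rank. Different colours give adjacent
    images, distinct by irreflexivity; within one colour, the block has no repetition. *)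
Lemma transprod_embedding k (col : VH -> 'I_k) (x0 : V) (bs : seq (seq V)) :
  (forall u v, eH u v -> col u != col v) ->
  size bs = k -> all (fun b => (size b == #|VH|) && uniq b) bs ->
  transprod (fun s : seq V => (pairwise e s)%:R : R) bs != 0 ->
  contains_subgraph eH e.
Proof.
move=> colP sbs bsP Tn0.
pose blk i := nth [::] bs i.
have blkP (i : 'I_k) : size (blk i) = #|VH| /\ uniq (blk i).
  by have /allP/(_ (blk i)) := bsP; rewrite mem_nth ?sbs // => /(_ isT)/andP[/eqP].
pose f u := nth x0 (blk (col u)) (enum_rank u).
(* The transversal [s] passes through both images. In the remaining blocks the choice is arbitrary,
   and the rank of [v] serves. *)
have fE u v : (col u < col v)%N -> e (f u) (f v).
  move=> uv; pose s := mkseq (fun i => nth x0 (blk i)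
     (if i == col u then enum_rank u else enum_rank v)) k.
  have ps : pairwise e s.
    have := @transprod_neq0 R _ _ _ s Tn0; rewrite size_mkseq sbs => /(_ erefl) H.
    have {H} : (pairwise e s)%:R != 0 :> R.
      apply: H => i ik y; rewrite /s (set_nth_default x0) ?size_mkseq // nth_mkseq //.
      have [si _] := blkP (Ordinal ik); rewrite mem_nth // si.
      by case: ifP.
    by case: (pairwise e s) => //; rewrite eqxx.
  have /(pairwiseP x0) := ps; rewrite size_mkseq => /(_ (col u) (col v)).
  rewrite !inE !ltn_ord !nth_mkseq // eqxx => /(_ isT isT uv).
  by rewrite eq_sym (ltn_eqF uv).
have fN u v : col u != col v -> e (f u) (f v).
  rewrite neq_ltn => /orP[uv|vu]; first exact: fE.
  by rewrite se; apply: fE.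
exists f; split=> [u v fuv|u v /colP]; last exact: fN.
have cuv : col u = col v.
  by apply/eqP; apply/negPn/negP => /fN; rewrite fuv ie.
have [sb ub] := blkP (col v); move/eqP: fuv; rewrite /f cuv.
by rewrite nth_uniq ?sb // => /eqP/val_inj/enum_rank_inj.
Qed.

(* In a blow-up of a clique vertices of different blocks are adjacent, hence
   distinct, so only repetitions inside one block can prevent an embedding. *)
Lemma H_free_density k (p : V -> R) (d : R) :
  expectation predT (avg p) -> (forall v, 0 <= p v <= d) ->
  colorable eH k -> H_free eH e ->
  clique_density p e k ^+ (#|VH| ^ k)%N <= k%:R * ((#|VH| ^ 2)%:R * d).
Proof.
move=> ep pd [col colP] hf; set h := #|VH|.
have [|x0 _ _] := expect_gt0 ep (f := fun=> 1); first by rewrite (expect1 ep) ltr01.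
have eh := iterE_expectation h ep; have eb := iterE_expectation k eh.
apply: le_trans (blowup_expectation h k ep _) _; first by move=> s.
apply: le_trans (ler_wpM2l (ler0n _ _) (iterE_repeat h ep pd)).
rewrite -(iterE_sum k _ eh); apply: (expect_le eb) => bs /andP[/eqP sbs bsP].
have sum0 : 0 <= \sum_(b <- bs) (~~ uniq b)%:R :> R by apply: sumr_ge0.
have [T0|T0] := eqVneq (transprod (fun s : seq V => (pairwise e s)%:R : R) bs) 0.
  by rewrite T0.
have [bsU|] := boolP (all uniq bs).
  case: hf; apply: transprod_embedding colP sbs _ T0 => //.
  apply/allP => b bb; rewrite (allP bsU _ bb) andbT.
  by have /andP[] := allP bsP _ bb.
rewrite -has_predC => /hasP[b bb /= nub].
(* The remaining case: a repetition in some block makes the right side at least 1. *)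
apply: (@le_trans _ _ 1); first by apply: transprod_le1 => s; rewrite lern1 leq_b1 ler0n.
rewrite (big_rem b) //= nub lerDl.
by apply: sumr_ge0.
Qed.

End Embedding.
End Supersaturation.

(** * Tensor contractions as sums over vertex sequences *)

Lemma codom_full_index n m (i : 'I_n) (s : {ffun 'I_m -> 'I_n}) :
  codom (@full_index n m.+1 i s) = i :: codom s.
Proof.
rewrite /codom /image_mem enum_ordSl /= {1}/full_index unlift_none; congr (_ :: _).
by rewrite -map_comp; apply: eq_map => k /=; rewrite /full_index liftK.
Qed.

(** Full cardinality of the image says that the indices are distinct, which [pairwise e] also
    enforces by irreflexivity. *)
Lemma is_t_clique_codom n m (e : rel 'I_n) (i : 'I_n) (s : {ffun 'I_m -> 'I_n}) :
  simple_graph e ->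
  is_t_clique m.+1 e [set @full_index n m.+1 i s j | j in 'I_m.+1] =
  pairwise e (i :: codom s).
Proof.
move=> [se ie]; rewrite -codom_full_index; set g := full_index _ _.
rewrite /is_t_clique -[X in _ == X](card_ord m.+1).
have -> : (#|[set g j | j in 'I_m.+1]| == #|'I_m.+1|) = uniq (codom g).
  apply/imset_injP/injectiveP => gi; first by move=> x y; apply: gi.
  by move=> x y _ _; apply: gi.
apply/andP/idP => [[ug /forall_inP ge]|pg].
  move: (ug); rewrite uniq_pairwise => ug'.
  apply: (sub_in_pairwise (P := mem (codom g))) ug'; last by apply/allP.
  move=> u v /codomP[j ->] /codomP[k ->] /= gjk.
  have /ge/forall_inP/(_ (g k)) : g j \in [set g j | j in 'I_m.+1] by apply: imset_f.
  by rewrite gjk; apply; apply: imset_f.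
split; first exact: pairwise_uniq ie pg.
have lt_e (j k : 'I_m.+1) : (j < k)%N -> e (g j) (g k).
  move: pg; rewrite /codom /image_mem pairwise_map => /(pairwiseP j).
  rewrite -cardE card_ord => /(_ j k); rewrite !inE !ltn_ord => H jk.
  by have := H isT isT jk; rewrite /= !nth_ord_enum.
apply/forall_inP => _ /imsetP[j _ ->]; apply/forall_inP => _ /imsetP[k _ ->].
apply/implyP => gjk; have : j != k by apply: contraNneq gjk => ->.
by rewrite neq_ltn => /orP[|]; [|rewrite se]; apply: lt_e.
Qed.

Lemma sum_ffun_iterE (R : realFieldType) (V : finType) (p : V -> R) m (F : seq V -> R) :
  \sum_(s : {ffun 'I_m -> V}) F (codom s) * \prod_k p (s k) = iterE (avg p) m F.
Proof.
elim: m F => [|m IHm] F.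
  have s0 (s : {ffun 'I_0 -> V}) : codom s = [::].
    by apply: size0nil; rewrite size_codom card_ord.
  rewrite (eq_bigr (fun=> F [::])) => [|s _]; last by rewrite s0 big_ord0 mulr1.
  by rewrite sumr_const card_ffun card_ord expn0 mulr1n.
pose h (vs : V * {ffun 'I_m -> V}) : {ffun 'I_m.+1 -> V} :=
  [ffun j => if unlift ord0 j is Some k then vs.2 k else vs.1].
pose h' (s : {ffun 'I_m.+1 -> V}) := (s ord0, [ffun k => s (lift ord0 k)]).
have hK : cancel h h'.
  case=> v s; rewrite /h /h' ffunE unlift_none; congr (_, _).
  by apply/ffunP => k; rewrite !ffunE liftK.
have h'K : cancel h' h.
  by move=> s; apply/ffunP => j; rewrite ffunE; case: unliftP => [k|] -> //=; rewrite ffunE.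
rewrite (reindex h) /=; last by exists h' => s _.
rewrite -(pair_bigA _ (fun v s => F (codom (h (v, s))) * \prod_k p (h (v, s) k))) /=.
apply: eq_bigr => v _; rewrite -IHm mulr_sumr; apply: eq_bigr => s _.
rewrite big_ord_recl {2}/h ffunE unlift_none mulrCA; congr (_ * (F _ * _)).
  rewrite /codom /image_mem enum_ordSl /= {1}/h ffunE unlift_none; congr (_ :: _).
  by rewrite -map_comp; apply: eq_map => k /=; rewrite /h ffunE liftK.
by apply: eq_bigr => k _; rewrite /h ffunE liftK.
Qed.

(** * Eigenvalues of the clique tensor and clique densities *)

Section CliqueTensor.
Variable R : realType.
Local Notation C := R[i].

Lemma iterE_avgZ (V : finType) (p : V -> R) c k F :
  iterE (avg (fun v => c * p v)) k F = c ^+ k * iterE (avg p) k F.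
Proof.
elim: k F => [|k IHk] F /=; first by rewrite expr0 mul1r.
by rewrite exprS /avg mulr_sumr; apply: eq_bigr => v _; rewrite IHk; ring.
Qed.

Lemma tensor_applyC n m (e : rel 'I_n) (y : 'I_n -> R) i : simple_graph e ->
  tensor_apply m.+1 e (fun j => (y j)%:C%C) i =
  (iterE (avg y) m (fun s => (pairwise e (i :: s))%:R) / m`!%:R)%:C%C.
Proof.
move=> ge; rewrite -sum_ffun_iterE mulr_suml rmorph_sum /=.
apply: eq_bigr => s _; rewrite /clique_tensor is_t_clique_codom //.
rewrite !rmorphM rmorph_prod /= -mulrA [_ * (_^-1)%:C%C]mulrC mulrA; congr (_ * _).
by case: ifP => _; rewrite ?mul0r ?mul1r // fmorphV /= rmorph_nat.
Qed.

Lemma normc_tensor_apply n m (e : rel 'I_n) (x : 'I_n -> C) i : simple_graph e ->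
  ComplexField.Normc.normc (tensor_apply m.+1 e x i) <=
  iterE (avg (fun j => ComplexField.Normc.normc (x j))) m
    (fun s => (pairwise e (i :: s))%:R) / m`!%:R.
Proof.
move=> ge; rewrite -lecR -tensor_applyC // -[leLHS]/(`|tensor_apply m.+1 e x i|).
apply: le_trans (ler_norm_sum _ _ _) _; apply: ler_sum => s _.
rewrite normrM normr_prod /clique_tensor; case: ifP => _; last by rewrite normr0 !mul0r.
by rewrite ger0_norm // invr_ge0 ler0n.
Qed.

Lemma eigenvalue_clique_density n m (e : rel 'I_n) (lam : C) : simple_graph e ->
  tensor_eigenvalue m.+1 e lam ->
  exists p : 'I_n -> R, let q := ComplexField.Normc.normc lam in
  [/\ expectation predT (avg p), forall i, 0 <= p i,
      forall i, q * p i ^+ m <= 1 &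
      q * m`!%:R <= n%:R ^+ m * clique_density p e m.+1].
Proof.
move=> ge [x [[i0 xi0] eigx]].
pose y j := ComplexField.Normc.normc (x j).
have y0 j : 0 <= y j by rewrite /y -lecR; apply: (normr_ge0 (x j)).
pose S := \sum_j y j.
have S0 : 0 < S.
  rewrite /S (bigD1 i0) //= ltr_pwDl ?sumr_ge0 // lt_neqAle y0 andbT eq_sym.
  by apply: contraNneq xi0 => /ComplexField.Normc.eq0_normc ->.
pose p j := y j / S.
have p0 j : 0 <= p j by rewrite divr_ge0 // ltW.
have ep : expectation predT (avg p).
  by apply: avg_expectation => //; rewrite -mulr_suml divff // gt_eqF.
have yE j : y j = S * p j by rewrite /p mulrC divfK // gt_eqF.
(* The probability that [m] draws extend [i] to an ordered clique; its [p]-average is the clique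
   density of order [m.+1]. *)
pose D i := iterE (avg p) m (fun s => (pairwise e (i :: s))%:R).
set q := ComplexField.Normc.normc lam.
have q0 : 0 <= q by rewrite /q -lecR; apply: (normr_ge0 lam).
have qD i : q * p i ^+ m <= D i / m`!%:R.
  have := normc_tensor_apply m x i ge; rewrite eigx /= ComplexField.Normc.normcM -/q.
  have -> : ComplexField.Normc.normc (x i ^+ m) = y i ^+ m.
    rewrite /y; elim: (m) => [|k IHk].
      by rewrite !expr0 ComplexField.Normc.normc1.
    by rewrite !exprS ComplexField.Normc.normcM IHk.
  rewrite (_ : (fun j => _) = (fun j => S * p j)); last by apply: funext => j; rewrite -yE.
  rewrite iterE_avgZ yE exprMn mulrCA -mulrA ler_pM2l //.
  exact: exprn_gt0.
have D1 i : D i <= 1.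
  have em := iterE_expectation m ep; rewrite -(expect1 em).
  by apply: (expect_le em) => s _; rewrite lern1 leq_b1.
exists p; split=> // [i|].
  apply: le_trans (qD i) _; rewrite ler_pdivrMr ?mul1r ?ltr0n ?fact_gt0 //.
  by rewrite (le_trans (D1 i)) // ler1n fact_gt0.
have n0 : 0 < n%:R :> R by rewrite ltr0n; apply: leq_ltn_trans (ltn_ord i0).
have unif : expectation predT (avg (fun _ : 'I_n => n%:R^-1 : R)).
  apply: avg_expectation => [_|]; first by rewrite invr_ge0 ltW.
  by rewrite sumr_const card_ord -[LHS]mulr_natl divff // gt_eqF.
(* Power mean inequality: Jensen for the uniform distribution, under which [p] has mean
   [n%:R^-1]. *)
have hold : 1 <= n%:R ^+ m * \sum_i p i ^+ m.+1.
  have := jensen m.+1 unif (fun i _ => p0 i).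
  rewrite /avg -!mulr_sumr -[\sum_i p i]mulr_suml divff ?gt_eqF // mulr1.
  rewrite -(ler_pM2l (exprn_gt0 m.+1 n0)) -exprMn divff ?gt_eqF // expr1n.
  by rewrite exprSr -mulrA mulVKf ?gt_eqF.
have sumD : q * \sum_i p i ^+ m.+1 <= clique_density p e m.+1 / m`!%:R.
  rewrite mulr_sumr mulr_suml; apply: ler_sum => i _.
  by rewrite exprS mulrCA -mulrA; apply: ler_wpM2l.
move: sumD; rewrite ler_pdivlMr ?ltr0n ?fact_gt0 // => sumD.
apply: le_trans (ler_wpM2l (exprn_ge0 m (ltW n0)) sumD).
set u := \sum_i _ in hold *.
rewrite [leRHS](_ : _ = (q * m`!%:R) * (n%:R ^+ m * u)); last by ring.
by apply: ler_peMr => //; rewrite mulr_ge0.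
Qed.

End CliqueTensor.

(** * The lower bound construction *)

Section Turan.

Lemma eq_iterE (R : realFieldType) (T : Type) (A : (T -> R) -> R) k F G :
  (forall s, size s = k -> F s = G s) -> iterE A k F = iterE A k G.
Proof.
elim: k F G => [|k IHk] F G FG /=; first exact: FG.
by congr A; apply: funext => v; apply: IHk => s sk; apply: FG; rewrite /= sk.
Qed.

Lemma iterE_avg0 (R : realFieldType) (V : finType) (p : V -> R) k :
  iterE (avg p) k (fun=> 0) = 0.
Proof. by elim: k => //= k ->; rewrite /avg big1 // => v _; rewrite mulr0. Qed.

(* The balanced complete [r]-partite graph on the first [r * q] vertices, the
   others being isolated. *)
Definition turan (n r q : nat) : rel 'I_n := fun u v =>
  [&& (u < r * q)%N, (v < r * q)%N & (u %% r != v %% r)%N].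

Lemma turan_simple n r q : simple_graph (@turan n r q).
Proof.
split=> [u v|u]; last by rewrite /turan eqxx !andbF.
by rewrite /turan eq_sym andbCA.
Qed.

(** Residues modulo [r] properly colour this graph, so a copy of H would give an [r]-colouring of
    H. *)
Lemma turan_H_free n r q (VH : finType) (eH : rel VH) : (0 < r)%N ->
  chromatic_number_is eH r.+1 -> H_free eH (@turan n r q).
Proof.
move=> r0 [_ chi] [f [_ fe]]; suff /chi : colorable eH r by rewrite ltnn.
exists (fun u => Ordinal (ltn_pmod (f u) r0)) => u v /fe /and3P[_ _].
by apply: contra => /eqP[->].
Qed.

(** Each of the [q] runs of [r] consecutive integers meets every residue class once. *)
Lemma sum_mod_notin (r q : nat) (s : seq nat) :
  uniq s -> all (fun c => (c < r)%N) s ->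
  (\sum_(0 <= v < r * q) ((v %% r)%N \notin s) = (r - size s) * q)%N.
Proof.
move=> us sr; elim: q => [|q IHq]; first by rewrite !muln0 big_geq.
rewrite mulnS [(r + _)%N]addnC (@big_cat_nat _ _ _ (r * q)) ?leq_addr //= IHq.
rewrite -{1}[(r * q)%N]add0n big_addn addKn mulnS addnC; congr (_ + _)%N.
have -> : (\sum_(0 <= i < r) ((i + r * q) %% r \notin s) =
           \sum_(0 <= i < r) (i \notin s))%N.
  by apply: eq_big_nat => i /andP[_ ir]; rewrite addnC mulnC modnMDl modn_small.
rewrite /index_iota subn0 -big_mkcond /= sum1_count -[in RHS](size_iota 0 r).
rewrite -(count_predC (mem s) (iota 0 r)).
have -> : count (mem s) (iota 0 r) = size s.
  rewrite -size_filter; apply/perm_size/uniq_perm; rewrite ?filter_uniq ?iota_uniq //.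
  move=> c; rewrite mem_filter mem_iota /= add0n.
  by apply/andP/idP => [[]|cs] //; split=> //; apply: (allP sr).
by rewrite addKn; apply: eq_count => c.
Qed.

(** With 0/1 weights [iterE] counts sequences. The next vertex avoids the [size L] classes already
    used, leaving [q] choices in each other class. *)
Lemma turan_extensions (R : realFieldType) n r q k (L : seq 'I_n) :
  (r * q <= n)%N -> (0 < r)%N ->
  all (fun v : 'I_n => (v < r * q)%N) L -> uniq [seq (v %% r)%N | v : 'I_n <- L] ->
  iterE (avg (fun v : 'I_n => (v < r * q)%N%:R : R)) k
    (fun s => (pairwise (turan r q) s && all (fun u => all (turan r q u) L) s)%:R)
  = ((r - size L) ^_ k * q ^ k)%:R.
Proof.
move=> rqn r0; elim: k L => [|k IHk] L Lr Lu; first by rewrite ffactn0 expn0.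
pose col (v : 'I_n) := (v %% r)%N.
have [st _] := @turan_simple n r q.
rewrite /= /avg.
transitivity (\sum_(v < n) ((v < r * q)%N && (col v \notin map col L))%:R *
   ((r - (size L).+1) ^_ k * q ^ k)%:R : R).
  apply: eq_bigr => v _; have [vr|_] := boolP (v < r * q)%N; last by rewrite !mul0r.
  rewrite mul1r /=; have [vL|vL] := boolP (col v \in _) => /=.
    rewrite mul0r -[RHS](iterE_avg0 (fun v : 'I_n => (v < r * q)%N%:R) k).
    apply: eq_iterE => s _; case/mapP: vL => u uL cvu.
    rewrite [X in _ && (X && _)](_ : _ = false) ?andbF //.
    by apply/negbTE/allPn; exists u => //; rewrite /turan -/(col v) cvu eqxx !andbF.
  rewrite mul1r -(IHk (v :: L)) /=; [|by rewrite vr|by rewrite vL].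
  have vall : all (turan r q v) L.
    apply/allP => u uL; rewrite /turan vr (allP Lr) //=.
    by apply: contraNneq vL; rewrite -/(col v) -/(col u) => ->; apply: map_f.
  apply: eq_iterE => s _; rewrite vall /=; congr (_%:R); congr nat_of_bool.
  rewrite -andbA andbCA; congr (_ && _); rewrite -all_predI; apply: eq_all => u /=.
  by rewrite st.
rewrite -mulr_suml -natr_sum -natrM; congr (_%:R).
rewrite (eq_bigr (fun v : 'I_n => if (v < r * q)%N then
    (v %% r)%N \notin map col L : nat else 0%N)); last first.
  by move=> v _; case: ifP.
rewrite -big_mkcond -(big_ord_widen _ (fun v => ((v %% r)%N \notin map col L : nat)) rqn).
rewrite -(big_mkord xpredT (fun v => ((v %% r)%N \notin map col L : nat))).
rewrite sum_mod_notin ?size_map //; last first.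
  by apply/allP => _ /mapP[u _ ->]; apply: ltn_pmod.
rewrite ffactnS expnS subnS; ring.
Qed.

Lemma turan_eigenvalue (R : realType) n m q :
  (0 < q)%N -> (m.+2 * q <= n)%N ->
  tensor_eigenvalue m.+2 (@turan n m.+2 q) ((q ^ m.+1)%:R : R[i]).
Proof.
move=> q0 rqn; set e := turan _ _.
have rq0 : (0 < m.+2 * q)%N by rewrite muln_gt0.
have ge : simple_graph e := turan_simple n m.+2 q.
pose y (v : 'I_n) : R := (v < m.+2 * q)%N%:R.
exists (fun v => (y v)%:C%C); split.
  by exists (Ordinal (leq_trans rq0 rqn)); rewrite /y /= rq0 oner_eq0.
move=> i; rewrite tensor_applyC //.
have [ir|ir] := boolP (i < m.+2 * q)%N; last first.
  rewrite (_ : iterE _ _ _ = 0).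
    by rewrite mul0r /y (negbTE ir) expr0n mulr0.
  rewrite -[RHS](iterE_avg0 y m.+1); apply: eq_iterE => -[|v s] //= _.
  by rewrite /e {1}/turan (negbTE ir).
have iq : all (fun v : 'I_n => (v < m.+2 * q)%N) [:: i] by rewrite /= ir.
(* There are [m.+1]! [q ^ m.+1] ordered extensions of [i], and the factorial cancels the tensor
   normalization. *)
have := turan_extensions R m.+1 rqn isT iq isT.
rewrite subSS subn0 ffactnn => H.
rewrite (_ : iterE _ _ _ = (m.+1`! * q ^ m.+1)%:R); last first.
  rewrite -H; apply: eq_iterE => s _ /=; congr (_%:R); congr nat_of_bool.
  by rewrite andbC; congr (_ && _); apply: eq_all => u /=; rewrite andbT (proj1 ge).
rewrite natrM mulrC mulKf ?pnatr_eq0 -?lt0n ?fact_gt0 //.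
by rewrite /y ir expr1n mulr1 rmorph_nat.
Qed.

End Turan.

(** * Bounds on the extremal spectral radius *)

Section Extremal.
Variable R : realType.
Variables (m : nat) (VH : finType) (eH : rel VH).
Local Notation r := m.+1.
Local Notation normc := ComplexField.Normc.normc.

(** A crude bound whose purpose is to show that the sets under [sup] are bounded above. *)
Lemma eigenvalue_le n (e : rel 'I_n) (lam : R[i]) : simple_graph e ->
  tensor_eigenvalue r e lam -> normc lam <= n%:R ^+ m.
Proof.
move=> ge /(eigenvalue_clique_density ge)[p /= [ep _ _ H]].
have := clique_density_le1 e ep r => t1.
have q0 : 0 <= normc lam by rewrite -lecR; apply: (normr_ge0 lam).
apply: le_trans (le_trans H _); first by rewrite ler_peMr // ler1n fact_gt0.
by rewrite ler_piMr // exprn_ge0.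
Qed.

Lemma H_free_eigenvalue_le (eps : R) : colorable eH r.+1 -> 0 < eps ->
  exists N : nat, forall n, (N <= n)%N -> forall e : rel 'I_n,
    simple_graph e -> H_free eH e -> forall lam : R[i],
    tensor_eigenvalue r e lam ->
    normc lam <= ((r%:R ^+ m)^-1 + eps) * n%:R ^+ m.
Proof.
(* The supersaturation error [c * (2 ^ r)%:R] must stay below [eps]. *)
move=> colH eps0; pose c := Num.min 1 (eps / (2 ^ r)%:R).
have c0 : 0 < c by rewrite lt_min ltr01 divr_gt0 // ltr0n expn_gt0.
have c1 : c <= 1 by rewrite ge_min lexx.
have c2 : c * (2 ^ r)%:R <= eps.
  by rewrite -ler_pdivlMr ?ltr0n ?expn_gt0 // ge_min lexx orbT.
(* H-freeness will bound a power of the (r+1)-clique density by [K / n], while supersaturation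
   bounds it below by [g]; so [n] beyond [K / g] is contradictory. *)
pose K : R := r.+1%:R * ((#|VH| ^ 2)%:R * r%:R).
pose g := (c * eps) ^+ (#|VH| ^ r.+1)%N.
have g0 : 0 < g by rewrite exprn_gt0 // mulr_gt0.
have r0 : 0 < r%:R :> R by rewrite ltr0n.
exists (Num.bound (K / g)).+1 => n Nn e ge hf lam eigl; rewrite leNgt.
have n0 : 0 < n%:R :> R by rewrite ltr0n (leq_trans _ Nn).
apply/negP => lamgt; have [p /= [ep p0 pl tl]] := eigenvalue_clique_density ge eigl.
set q := normc lam in lamgt pl tl.
have [se ie] := ge.
have nm0 : 0 < n%:R ^+ m :> R by rewrite exprn_gt0.
have q0 : n%:R ^+ m / r%:R ^+ m < q.
  by apply: le_lt_trans lamgt; rewrite mulrC ler_wpM2r ?lerDl ?(ltW nm0) ?(ltW eps0).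
(* A heavier vertex would violate [q * p v ^+ m <= 1], since [q] exceeds (n/r)^m. *)
have pd v : 0 <= p v <= r%:R / n%:R.
  rewrite p0 leNgt; apply/negP => pv.
  have q00 : 0 < q by apply: le_lt_trans q0; rewrite divr_ge0 ?exprn_ge0 ?ltW.
  have := pl v; apply/negP; rewrite -ltNge.
  have h : (r%:R / n%:R) ^+ m <= p v ^+ m.
    by rewrite lerXn2r ?nnegrE ?divr_ge0 ?(ltW r0) ?(ltW n0) ?(ltW pv) ?p0.
  apply: lt_le_trans (ler_wpM2l (ltW q00) h).
  rewrite -(ltr_pM2r (_ : 0 < (r%:R / n%:R) ^+ m)) ?exprn_gt0 ?divr_gt0 // in q0.
  move: q0; by rewrite expr_div_n mulrA divfK ?divff ?gt_eqF ?exprn_gt0.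
pose t := clique_density p e.
have h : ((r%:R ^+ m)^-1 + eps) * m`!%:R < t r.
  rewrite -(ltr_pM2l nm0); apply: lt_le_trans tl.
  by rewrite mulrA [_ * (_ + _)]mulrC ltr_pM2r // ltr0n fact_gt0.
have tr : r`!%:R / r%:R ^+ r + c * (2 ^ r)%:R < t r.
  apply: le_lt_trans h; rewrite mulrDl; apply: lerD.
    by rewrite factS natrM exprS invfM mulrACA divff ?gt_eqF // mul1r mulrC.
  by rewrite (le_trans c2) // ler_peMr ?(ltW eps0) // ler1n fact_gt0.
have teps : eps <= t r.
  apply: le_trans (ltW h); apply: le_trans (_ : (r%:R ^+ m)^-1 + eps <= _).
    by rewrite lerDr invr_ge0 exprn_ge0 // ltW.
  rewrite ler_peMr ?ler1n ?fact_gt0 // addr_ge0 ?(ltW eps0) // invr_ge0 exprn_ge0 // ltW.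
have tS := @clique_supersaturation R _ p e ep se r c isT _ tr.
have {}tS : c * t r < t r.+1 by apply: tS; rewrite c0.
have := H_free_density se ie ep pd colH hf.
apply/negP; rewrite -ltNge; apply: (@lt_le_trans _ _ g); last first.
  rewrite lerXn2r ?nnegrE ?mulr_ge0 ?(ltW c0) ?(ltW eps0) ?clique_density_ge0 //.
  by apply: le_trans (ltW tS); rewrite ler_pM2l.
rewrite !mulrA ltr_pdivrMr // -mulrA -/K -ltr_pdivrMl // mulrC.
apply: lt_le_trans (archi_boundP _) _; last by rewrite ler_nat ltnW.
by rewrite divr_ge0 ?(ltW g0) // !mulr_ge0.
Qed.

Lemma spectral_radius_ge n (e : rel 'I_n) (lam : R[i]) : simple_graph e ->
  tensor_eigenvalue r e lam -> normc lam <= clique_spectral_radius r e.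
Proof.
move=> ge eigl; apply: ub_le_sup; last by exists lam.
by exists (n%:R ^+ m) => _ [l el <-]; apply: eigenvalue_le el.
Qed.

(** The condition [0 <= c] covers the empty set, whose [sup] is 0 by convention. *)
Lemma sup_le_nneg (E : set R) (c : R) : 0 <= c -> ubound E c -> sup E <= c.
Proof.
move=> c0 Ec; have [->|/set0P E0] := eqVneq E set0; first by rewrite sup0.
exact: ge_sup.
Qed.

Lemma ex_mu_ge n (e : rel 'I_n) (lam : R[i]) : simple_graph e -> H_free eH e ->
  tensor_eigenvalue r e lam -> normc lam <= ex_mu r n eH.
Proof.
move=> ge hf eigl; apply: le_trans (spectral_radius_ge ge eigl) _.
apply: ub_le_sup; last by exists e.
exists (n%:R ^+ m) => _ [e' [ge' _ ->]].
apply: sup_le_nneg; first by rewrite exprn_ge0.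
by move=> _ [l el <-]; apply: eigenvalue_le el.
Qed.

End Extremal.

(* ex_{mu_r}(n,H) = (1/r^{r-1} + o(1)) n^{r-1} as n -> oo *)
Theorem theorem3 (R : realType) (r : nat) (VH : finType) (eH : rel VH) :
  (2 <= r)%N -> simple_graph eH -> chromatic_number_is eH r.+1 ->
  forall eps : R, 0 < eps -> exists N : nat, forall n : nat, (N <= n)%N ->
    `| ex_mu (R := R) r n eH - (r%:R ^+ r.-1)^-1 * n%:R ^+ r.-1 |
      <= eps * n%:R ^+ r.-1.
Proof.
case: r => [|[|k]] // _ _ chiH eps eps0; set m := k.+1; rewrite -/m /=.
have [N1 HN1] := H_free_eigenvalue_le (proj1 chiH) eps0.
(* Beyond [N2] the rounding loss, at most m n^(m-1), is below eps n^m; beyond [m.+1] the class size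
   [q] is positive. *)
pose N2 := Num.bound (m%:R / eps).
exists (maxn N1 (maxn m.+1 N2)) => n; rewrite !geq_max => /and3P[N1n rn N2n].
have n0 : 0 < n%:R :> R by rewrite ltr0n (leq_trans _ rn).
have nm0 : 0 < n%:R ^+ m :> R by rewrite exprn_gt0.
have r0 : 0 < m.+1%:R :> R by rewrite ltr0n.
rewrite ler_norml; apply/andP; split; last first.
  rewrite lerBlDr -mulrDl addrC; have b0 : 0 <= ((m.+1%:R ^+ m)^-1 + eps) * n%:R ^+ m.
    by rewrite mulr_ge0 ?addr_ge0 ?invr_ge0 ?exprn_ge0 ?ltW.
  apply: sup_le_nneg => // _ [e [ge hf ->]].
  by apply: sup_le_nneg => // _ [l el <-]; apply: HN1 el.
pose q := (n %/ m.+1)%N.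
have q0 : (0 < q)%N by rewrite divn_gt0.
have qn : (m.+1 * q <= n)%N by rewrite mulnC leq_divM.
have hf : H_free eH (@turan n m.+1 q) by apply: turan_H_free chiH.
have := ex_mu_ge (turan_simple n m.+1 q) hf (@turan_eigenvalue R n k q q0 qn).
have -> : ComplexField.Normc.normc ((q ^ m)%:R : R[i]) = q%:R ^+ m.
  by rewrite normcMn ComplexField.Normc.normc1 natrX.
move=> exq; rewrite lerBrDr; apply: le_trans exq.
set a : R := n%:R / m.+1%:R; have a0 : 0 <= a by rewrite divr_ge0 // ltW.
(* The tangent at [a] = n/r bounds [q ^ m] below; rounding gives [q - a >= -1], so the loss is at
   most m a^(m-1). *)
apply: le_trans (exprn_tangent k a0 (ler0n R q)).
rewrite -/m expr_div_n addrC [_^-1 * _]mulrC lerD2l.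
have qa : -1 <= q%:R - a.
  rewrite lerBrDr addrC lerBlDr /a ler_pdivrMr // natr1 -natrM ler_nat.
  by apply: ltnW; rewrite ltn_ceil.
have man : m%:R * a ^+ k <= eps * n%:R ^+ m.
  have an : a <= n%:R by rewrite ler_pdivrMr // ler_peMr ?ler1n // ltW.
  apply: (@le_trans _ _ (m%:R * n%:R ^+ k)).
    by rewrite ler_wpM2l // lerXn2r ?nnegrE // ltW.
  rewrite exprS mulrA ler_wpM2r ?exprn_ge0 ?(ltW n0) // mulrC -ler_pdivrMr //.
  apply: le_trans (ltW (archi_boundP _)) _; last by rewrite ler_nat.
  by rewrite divr_ge0 // ltW.
have := ler_wpM2l (mulr_ge0 (ler0n R m) (exprn_ge0 k a0)) qa.
by apply: le_trans; rewrite mulrN1 lerN2.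
Qed.
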